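(* For every integer $t\geq 3$ there exists a constant $C_t$ such that for every positive integer $n$, $$\mathrm{ex}(n,H_t)\leq C_t\, n^{1+\frac{t-2}{2t-3}}=C_t\, n^{3/2-\frac{1}{4t-6}}.$$
   Context: For a graph $H$, $\mathrm{ex}(n,H)$ denotes the maximum number of edges in an $n$-vertex graph containing no subgraph isomorphic to $H$. The subdivision of a graph $L$ is the bipartite graph with parts $V(L)$ and $E(L)$ in which $v\in V(L)$ is adjacent to $e\in E(L)$ if and only if $v$ is an endpoint of $e$. $H_t$ denotes the subdivision of the complete graph $K_t$. *)

(* Defs.v *)
From mathcomp Require Import all_boot.
Set Implicit Arguments. Unset Strict Implicit. Unset Printing Implicit Defensive.

Definition simple_graph (n : nat) (E : {set {set 'I_n}}) : bool :=
  [forall S in E, #|S| == 2].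

Definition adj (n : nat) (E : {set {set 'I_n}}) (x y : 'I_n) : bool :=
  (x != y) && ([set x; y] \in E).

Definition contains_sub (U : finType) (h : rel U) (n : nat) (E : {set {set 'I_n}}) : bool :=
  [exists f : {ffun U -> 'I_n},
     injectiveb f && [forall x, forall y, h x y ==> adj E (f x) (f y)]].

Definition ex (U : finType) (h : rel U) (n : nat) : nat :=
  \max_(E : {set {set 'I_n}} | simple_graph E && ~~ contains_sub h E) #|E|.

(* The subdivision H_t of K_t: parts V(K_t) = 'I_t and E(K_t) = 2-subsets of 'I_t *)
Definition Kedge (t : nat) := {S : {set 'I_t} | #|S| == 2}.
Definition Hvert (t : nat) : finType := ('I_t + Kedge t)%type.
Definition Hrel (t : nat) : rel (Hvert t) := fun a b =>
  match a, b with
  | inl v, inr e => v \in val e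
  | inr e, inl v => v \in val e
  | _, _ => false
  end.

(* Main.v *)
(* Call two vertices of a bipartite graph light if they have at least one but
   fewer than e(K_t) common neighbours, and heavy if they have e(K_t) or more. A
   heavy t-clique extends greedily to H_t, so in an H_t-free graph every
   neighbourhood has, by Turan, a positive proportion of light pairs; hence if
   all vertices of U have degree at least d towards a side of size b, some
   u in U has about |U| d^2 / b light neighbours in U. Iterating inside the
   light neighbourhood, while avoiding the neighbours of the common neighbours
   already seen, builds a light t-clique without a common neighbour of three
   of its vertices, that is, a copy of H_t.
   The last removal needs the degrees on the side of size b to be at most a
   constant times their average. This is arranged by passing to a subset S of
   that side maximising e(S)^4 / |S| and deleting its vertices of large
   degree. *)
Require Import Defs.
From mathcomp Require Import all_boot zify.
From Stdlib Require Import Reals Lra.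
(* Reals rebinds ^ on nat to Nat.pow. *)
Import ssrnat.
Set Implicit Arguments. Unset Strict Implicit. Unset Printing Implicit Defensive.

(** * Copies of [H_t] from heavy and from clean cliques *)

(** A copy of [H_t] with branch vertices in [X] and subdivision vertices in [Y]; two separate types
    keep the sides apart. *)
Definition subdiv_in (X Y : finType) (t : nat) (r : X -> Y -> bool) : Prop :=
  exists (u : 'I_t -> X) (w : Kedge t -> Y),
    [/\ injective u, injective w & forall i (e : Kedge t), i \in val e -> r (u i) (w e)].

Definition codeg (X Y : finType) (r : X -> Y -> bool) (x x' : X) : nat :=
  #|[set y | r x y && r x' y]|.

Definition light (X Y : finType) (t : nat) (r : X -> Y -> bool) (x x' : X) : bool :=
  [&& x != x', 0 < codeg r x x' & codeg r x x' < #|{: Kedge t}|].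

(** Greedy choice: fewer than [#|I|] values are taken at any moment, so every [S i] still has a free
    element. *)
Lemma distinct_representatives (I Y : finType) (S : I -> {set Y}) :
  (forall i, #|I| <= #|S i|) -> exists2 f, injective f & forall i, f i \in S i.
Proof.
move=> HS.
have S0 i : exists y, y \in S i.
  apply/set0Pn; rewrite -card_gt0; apply: leq_trans (HS i).
  by apply/card_gt0P; exists i.
suff [f finj fS] : exists2 f, {in enum I &, injective f} & forall i, f i \in S i.
  by exists f => // i j; apply: finj; rewrite mem_enum.
elim: (enum I) (enum_uniq I) => [_|i s IHs /= /andP[nis us]].
  by exists (fun i => xchoose (S0 i)) => // i; apply: xchooseP.
have [f finj fS] := IHs us.
have [y yS ynf] : exists2 y, y \in S i & y \notin map f s.
  apply/subsetPn; apply/negP => /subset_leq_card le.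
  have := leq_trans (HS i) (leq_trans le (card_size _)).
  rewrite size_map leqNgt => /negP; apply.
  have := max_card (mem (i :: s)); rewrite (card_uniqP _) //=.
  by rewrite nis.
exists (fun j => if j == i then y else f j); last by move=> j; case: eqP => [->|].
have fy j : j \in s -> f j <> y by move=> js e; move: ynf; rewrite -e map_f.
move=> j k; rewrite !inE.
case: eqP => [->|_] /=; case: eqP => [->|_] //=.
- by move=> _ ks e; case: (fy _ ks).
- by move=> js _ e; case: (fy _ js).
- exact: finj.
Qed.

Lemma KedgeP (t : nat) (e : Kedge t) : exists i j, i != j /\ val e = [set i; j].
Proof.
by have /cards2P[i [j [ij ->]]] := valP e; exists i, j.
Qed.

Lemma heavy_clique (X Y : finType) (t : nat) (r : X -> Y -> bool) (u : 'I_t -> X) :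
  injective u -> (forall i j, i != j -> #|{: Kedge t}| <= codeg r (u i) (u j)) ->
  subdiv_in t r.
Proof.
move=> uinj hv.
have [|w winj wS] := @distinct_representatives (Kedge t) Y
  (fun e => [set y | [forall i in val e, r (u i) y]]).
  move=> e; have [i [j [ij Ee]]] := KedgeP e.
  apply: leq_trans (hv _ _ ij) _; apply: subset_leq_card; apply/subsetP => y.
  rewrite !inE => /andP[ri rj]; apply/forall_inP => k.
  by rewrite Ee !inE => /orP[]/eqP->.
exists u, w; split=> // i e ie.
by have := wS e; rewrite inE => /forall_inP; apply.
Qed.

(* Midpoints of distinct pairs are automatically distinct, since a vertex
   determines the pair of the [u i] adjacent to it. *)
Lemma clean_clique (X Y : finType) (t : nat) (r : X -> Y -> bool) (u : 'I_t -> X) :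
  injective u -> (forall i j, i != j -> 0 < codeg r (u i) (u j)) ->
  (forall y, #|[set i | r (u i) y]| <= 2) -> subdiv_in t r.
Proof.
move=> uinj co le2.
have Sw (e : Kedge t) : exists y, [forall i in val e, r (u i) y].
  have [i [j [ij Ee]]] := KedgeP e.
  have /card_gt0P[y] := co _ _ ij; rewrite inE => /andP[ri rj].
  by exists y; apply/forall_inP => k; rewrite Ee !inE => /orP[]/eqP->.
have valE (e : Kedge t) y : [forall i in val e, r (u i) y] -> val e = [set i | r (u i) y].
  move=> /forall_inP ey; apply/eqP; rewrite eqEcard (eqP (valP e)) le2 andbT.
  by apply/subsetP => i /ey; rewrite inE.
exists u, (fun e => xchoose (Sw e)); split=> //.
- move=> e e' Ew; apply: val_inj.
  by rewrite (valE _ _ (xchooseP (Sw e))) (valE _ _ (xchooseP (Sw e'))) Ew.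
- by move=> i e; have /forall_inP := xchooseP (Sw e); apply.
Qed.

(** * Light pairs: a Turan bound and double counting *)

(** A maximal [L]-independent [Q] in [S] has fewer than [t] elements, and by maximality each vertex
    of [S] outside [Q] has an [L]-neighbour in [Q]; averaging over [Q] gives [v]. *)
Lemma dense_vertex (X : finType) (L : rel X) (t : nat) (S : {set X}) :
  symmetric L ->
  (forall Q : {set X}, Q \subset S -> {in Q &, forall x y, x != y -> ~~ L x y} -> #|Q| < t) ->
  t < #|S| ->
  exists2 v, v \in S & #|S| - t <= t * \sum_(x in S :\ v) L v x.
Proof.
move=> Lsym cl tS.
pose ind (Q : {set X}) :=
  (Q \subset S) && [forall x in Q, forall y in Q, (x != y) ==> ~~ L x y].
have [|Q /maxsetP[/andP[QS Qi] Qmax]] := @ex_maxset _ ind.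
  by exists set0; rewrite /ind sub0set; apply/forall_inP => x; rewrite inE.
have QiP : {in Q &, forall x y, x != y -> ~~ L x y}.
  move=> x y xQ yQ; move: Qi => /forall_inP/(_ x xQ)/forall_inP/(_ y yQ).
  by move/implyP.
have Qt := cl _ QS QiP.
have hit x : x \in S :\: Q -> 1 <= \sum_(v in Q) L v x.
  rewrite inE => /andP[xQ xS]; rewrite lt0n sum_nat_eq0; apply/negP => /forall_inP H.
  have Lx v : v \in Q -> ~~ L v x by move=> /H; rewrite eqb0.
  case/negP: xQ; rewrite -(Qmax (x |: Q)) ?subsetU1 ?setU11 //.
  rewrite /ind subUset sub1set xS QS /=.
  apply/forall_inP => v; rewrite !inE => vQ; apply/forall_inP => z; rewrite !inE => zQ.
  apply/implyP => vz.
  case/orP: vQ => [/eqP ev|vQ]; case/orP: zQ => [/eqP ez|zQ].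
  - by move: vz; rewrite ev ez eqxx.
  - by rewrite ev Lsym Lx.
  - by rewrite ez Lx.
  - exact: QiP.
have tot : #|S| - #|Q| <= \sum_(v in Q) \sum_(x in S :\ v) L v x.
  rewrite -cardsDS // -sum1_card.
  apply: leq_trans (leq_sum _ (fun x => hit x)) _.
  rewrite exchange_big /=; apply: leq_sum => v vQ.
  rewrite [X in _ <= X](bigID (fun x => x \in Q)) /=; apply: leq_trans (leq_addl _ _).
  apply: eq_leq; apply: eq_bigl => x; rewrite !inE.
  case: eqP => [->|_] //=; first by rewrite vQ.
  by rewrite andbC.
have [/exists_inP[v vS Hv]|] := boolP [exists v in S, #|S| - t <= t * \sum_(x in S :\ v) L v x].
  by exists v.
rewrite negb_exists_in => /forall_inP H.
have : t * (#|S| - #|Q|) <= #|Q| * (#|S| - t).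
  apply: leq_trans (leq_mul (leqnn t) tot) _.
  rewrite big_distrr /= -sum_nat_const; apply: leq_sum => v vQ.
  by have := H v (subsetP QS _ vQ); rewrite -ltnNge => /ltnW.
nia.
Qed.

(** Induction on [#|S|], removing the vertex of [dense_vertex]: its pairs count in both orders,
    which covers the increment of the square. *)
Lemma clique_free_pairs (X : finType) (L : rel X) (t : nat) (S : {set X}) :
  symmetric L ->
  (forall Q : {set X}, Q \subset S -> {in Q &, forall x y, x != y -> ~~ L x y} -> #|Q| < t) ->
  (#|S| - t) ^ 2 <= t * \sum_(x in S) \sum_(x' in S) L x x'.
Proof.
move=> Lsym; move Em : #|S| => m; elim: m S Em => [|m IHm] S Em cl //.
have [le|lt] := leqP m.+1 t.
  by rewrite (eqP (le : m.+1 - t == 0)).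
rewrite -Em in lt; have [v vS Hv] := dense_vertex Lsym cl lt.
have Sm := Em; rewrite (cardsD1 v) vS add1n in Em; case: Em => Em.
have IH := IHm _ Em.
have {}IH := IH (fun Q QS => cl Q (subset_trans QS (subD1set _ _))).
rewrite (big_setD1 v) //= (big_setD1 v) //=.
have -> : \sum_(x in S :\ v) \sum_(x' in S) L x x' =
    \sum_(x in S :\ v) (L v x + \sum_(x' in S :\ v) L x x').
  by apply: eq_bigr => x _; rewrite (big_setD1 v) //= Lsym.
rewrite big_split /=.
set d := \sum_(x in S :\ v) L v x in Hv *.
set e := \sum_(x in S :\ v) \sum_(_ in _) _ in IH *.
rewrite Sm in Hv lt.
have [k Ek] : exists k, m = k + t by exists (m - t); lia.
rewrite Ek in Hv IH *; rewrite addnK in IH.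
have E1 : (k + t).+1 - t = k.+1 by lia.
rewrite E1 in Hv *.
rewrite !expnS expn0 !muln1 in IH *; nia.
Qed.

Lemma sum_squares_ge (Y : finType) (B : {set Y}) (f : Y -> nat) :
  (\sum_(y in B) f y) ^ 2 <= #|B| * \sum_(y in B) f y ^ 2.
Proof.
suff : 2 * (\sum_(y in B) f y) ^ 2 <= 2 * (#|B| * \sum_(y in B) f y ^ 2) by lia.
rewrite expnS expn1 big_distrl /= big_distrr /=.
have -> : 2 * (#|B| * \sum_(y in B) f y ^ 2) =
    \sum_(y in B) \sum_(z in B) (f y ^ 2 + f z ^ 2).
  rewrite (eq_bigr _ (fun y _ => big_split _ _ _ _ _)) /= big_split /= sum_nat_const.
  by rewrite exchange_big /= sum_nat_const; lia.
apply: leq_sum => y _; rewrite big_distrr big_distrr /=; apply: leq_sum => z _.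
exact: nat_Cauchy.
Qed.

Lemma codegC (X Y : finType) (r : X -> Y -> bool) x x' : codeg r x x' = codeg r x' x.
Proof. by apply: eq_card => y; rewrite !inE andbC. Qed.

Lemma lightC (X Y : finType) (t : nat) (r : X -> Y -> bool) : symmetric (light t r).
Proof. by move=> x x'; rewrite /light codegC eq_sym. Qed.

(** The Turan bound in the neighbourhood [N y] of each [y], summed over [B] by Cauchy-Schwarz, gives
    many light pairs in [U]; the best [u] is then at least average. *)
Lemma light_neighbour (X Y : finType) (t : nat) (r : X -> Y -> bool)
    (U : {set X}) (B : {set Y}) (d b : nat) :
  ~ subdiv_in t r -> (forall x y, r x y -> y \in B) -> #|B| <= b ->
  (forall x, x \in U -> d <= #|[set y | r x y]|) ->
  0 < #|U| -> 2 * t * b <= #|U| * d ->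
  exists2 u, u \in U &
    #|U| * d ^ 2 <= 4 * t * #|{: Kedge t}| * b * #|[set x in U | light t r u x]|.
Proof.
move=> Hfree rB Bb degU U0 Ub; set q := #|{: Kedge t}|.
pose N y := [set x in U | r x y].
have sumN : #|U| * d <= \sum_(y in B) #|N y|.
  rewrite -sum_nat_const; apply: leq_trans (leq_sum _ degU) _.
  rewrite (eq_bigr (fun y => \sum_(x in U) r x y)); last first.
    by move=> y _; rewrite -sum1dep_card big_mkcondr.
  rewrite exchange_big /=; apply: leq_sum => x xU.
  rewrite -sum1dep_card big_mkcond [X in _ <= X]big_mkcond /=.
  apply: leq_sum => y _; case rxy: (r x y) => //=.
  by rewrite (rB _ _ rxy).
have pairsN y : y \in B ->
    (#|N y| - t) ^ 2 <= t * \sum_(x in N y) \sum_(x' in N y) light t r x x'.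
  move=> yB; apply: clique_free_pairs; first exact: lightC.
  move=> Q QN Qh; rewrite ltnNge; apply/negP => tQ; apply: Hfree.
  have uinj : injective (fun i : 'I_t => enum_val (widen_ord tQ i)).
    by move=> i j /enum_val_inj/(congr1 val)/= /val_inj.
  apply: (heavy_clique uinj) => i j ij.
  have := Qh _ _ (enum_valP (widen_ord tQ i)) (enum_valP (widen_ord tQ j)).
  rewrite (inj_eq uinj) => /(_ ij).
  (* Vertices of [N y] have the common neighbour [y], so a pair that is not light is heavy. *)
  rewrite /light (inj_eq uinj) ij /= negb_and -leqNgt -leqNgt.
  case/orP => // /(leq_trans _) c0; exfalso.
  suff : codeg r (enum_val (widen_ord tQ i)) (enum_val (widen_ord tQ j)) <= 0 -> False.
    by apply; apply: c0.
  apply/negP; rewrite -ltnNge; apply/card_gt0P; exists y; rewrite inE.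
  have := subsetP QN _ (enum_valP (widen_ord tQ i)).
  have := subsetP QN _ (enum_valP (widen_ord tQ j)).
  by rewrite !inE => /andP[_ ->] /andP[_ ->].
pose P := \sum_(x in U) \sum_(x' in U) light t r x x'.
(* A light pair lies in [N y] for fewer than [q] vertices [y], so exchanging the sums costs a factor
   [q]. *)
have sumP : \sum_(y in B) (#|N y| - t) ^ 2 <= t * (q * P).
  apply: leq_trans (leq_sum _ pairsN) _; rewrite -big_distrr leq_mul2l; apply/orP; right.
  rewrite (eq_bigr (fun y => \sum_(x in U) \sum_(x' in U)
      (light t r x x' * (r x y && r x' y)))); last first.
    move=> y _; rewrite (eq_bigl (fun x => (x \in U) && r x y)); last by move=> x; rewrite inE.
    rewrite big_mkcondr; apply: eq_bigr => x _.
    case: (r x y) => /=; last by rewrite big1 // => x' _; rewrite muln0.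
    rewrite (eq_bigl (fun x => (x \in U) && r x y)); last by move=> x'; rewrite inE.
    rewrite big_mkcondr; apply: eq_bigr => x' _.
    by case: (r x' y); rewrite ?muln0 ?muln1.
  rewrite exchange_big big_distrr /=; apply: leq_sum => x _.
  rewrite exchange_big big_distrr /=; apply: leq_sum => x' _.
  rewrite -big_distrr /= mulnC; case L: (light t r x x'); last by rewrite !muln0.
  rewrite !muln1; case/and3P: L => _ _ /ltnW; apply: leq_trans.
  rewrite /codeg -sum1dep_card big_mkcond [X in _ <= X]big_mkcond /=.
  by apply: leq_sum => y _; case: ifP => //; case: ifP.
have sumNt : #|U| * d - t * b <= \sum_(y in B) (#|N y| - t).
  rewrite leq_subLR; apply: leq_trans sumN _.
  apply: leq_trans (_ : \sum_(y in B) (t + (#|N y| - t)) <= _).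
    by apply: leq_sum => y _; lia.
  by rewrite big_split sum_nat_const leq_add2r mulnC leq_mul2l Bb orbT.
have CS := sum_squares_ge B (fun y => #|N y| - t).
have big : (#|U| * d) ^ 2 <= 4 * t * q * b * P.
  (* By [2 * t * b <= #|U| * d], losing [t] at each vertex of [B] costs at most half of the sum. *)
  have H1 : #|U| * d <= 2 * (#|U| * d - t * b) by lia.
  apply: leq_trans (_ : 4 * (\sum_(y in B) (#|N y| - t)) ^ 2 <= _).
    by rewrite (_ : 4 = 2 ^ 2) // -expnMn leq_exp2r //; lia.
  apply: leq_trans (_ : 4 * (#|B| * \sum_(y in B) (#|N y| - t) ^ 2) <= _); first lia.
  apply: leq_trans (_ : 4 * (b * (t * (q * P))) <= _); last lia.
  by rewrite leq_mul2l /=; apply: leq_mul.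
have [/exists_inP[v vS Hv]|] := boolP [exists u in U, #|U| * d ^ 2 <=
    4 * t * #|{: Kedge t}| * b * #|[set x in U | light t r u x]|].
  by exists v.
rewrite negb_exists_in => /forall_inP H.
suff : 4 * t * q * b * P < #|U| * (#|U| * d ^ 2).
  by move: big; rewrite expnMn !expnS !expn0; lia.
rewrite big_distrr -sum_nat_const /=.
(* One term is split off to keep the inequality strict. *)
case/card_gt0P: U0 => u uU.
rewrite (big_setD1 u) //= [X in _ < X](big_setD1 u) //= -addSn.
have lt x : x \in U -> 4 * t * q * b * \sum_(x' in U) light t r x x' < #|U| * d ^ 2.
  move=> /H; rewrite -ltnNge; congr (_ * _ < _).
  by rewrite -sum1dep_card big_mkcondr.
apply: leq_add; first exact: lt.
by apply: leq_sum => x; rewrite !inE => /andP[_ /lt/ltnW].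
Qed.

(** * Growing a clean light clique *)

(** The partial clique under construction; [light] is irreflexive, so the entries are distinct. *)
Definition clean (X Y : finType) (t : nat) (r : X -> Y -> bool) (s : seq X) : bool :=
  pairwise (light t r) s && [forall y, count (r^~ y) s <= 2].

(** A [y] adjacent to three entries would either miss [x] or [u], against one of the two cleanness
    hypotheses, or meet both and some [v] in [s], which the last hypothesis forbids. *)
Lemma clean_cons2 (X Y : finType) (t : nat) (r : X -> Y -> bool) (x u : X) (s : seq X) :
  clean t r (x :: s) -> clean t r (u :: s) -> light t r x u ->
  (forall v y, v \in s -> r u y -> r v y -> ~~ r x y) -> clean t r [:: x, u & s].
Proof.
move=> /andP[/= /andP[xs ps] /forallP cx] /andP[/= /andP[us _] /forallP cu] xu tri.
rewrite /clean /= xu xs us ps; apply/forallP => y.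
have := cx y; have := cu y.
case ruy: (r u y) => //=; case rxy: (r x y) => //= _ _.
have -> // : count (r^~ y) s = 0.
apply/eqP; rewrite -leqn0 leqNgt -has_count; apply/negP => /hasP[v vs rvy].
by have := tri v y vs ruy rvy; rewrite rxy.
Qed.

Lemma clean_subdiv (X Y : finType) (t : nat) (r : X -> Y -> bool) (s : seq X) :
  size s = t -> clean t r s -> subdiv_in t r.
Proof.
move=> /eqP ss /andP[/(pairwiseP _) ps /forallP cs].
pose u (i : 'I_t) := tnth (Tuple ss) i.
have lu i j : i != j -> light t r (u i) (u j).
  wlog ij : i j / i < j.
    move=> W ij; have [lt|lt|/val_inj e] := ltngtP i j; first exact: W.
      by rewrite lightC; apply: W => //; rewrite eq_sym.
    by rewrite e eqxx in ij.
  move=> _; rewrite /u !(tnth_nth (u i)) /=.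
  by apply: ps; rewrite ?inE ?(eqP ss).
apply: (@clean_clique _ _ _ _ u).
- move=> i j e; apply/eqP; apply/negPn/negP => /lu.
  by rewrite /light e eqxx.
- by move=> i j /lu/and3P[].
- move=> y; apply: leq_trans (cs y).
  have <- : map u (enum 'I_t) = s by rewrite /u map_tnth_enum.
  by rewrite count_map -sum1_count big_enum_cond /= -sum1dep_card.
Qed.

(** These are the [x] that would violate the last hypothesis of [clean_cons2]. For each [v] in [s]
    there are fewer than [q] common neighbours of [u] and [v], each with at most [D] neighbours in
    [A]. *)
Lemma card_excluded (X Y : finType) (t : nat) (r : X -> Y -> bool) 
    (D : nat) (A U : {set X}) (u : X) (s : seq X) :
  U \subset A ->
  (forall y, #|[set x in A | r x y]| <= D) ->
  all (light t r u) s ->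
  #|[set x in U | [exists y, [&& r u y, r x y & has (r^~ y) s]]]| <=
    size s * (#|{: Kedge t}| * D).
Proof.
move=> UA degD; elim: s => [_|v s IHs /= /andP[uv us]].
  rewrite leqn0 cards_eq0; apply/eqP/setP => x; rewrite !inE.
  by apply/negP => /andP[_ /existsP[y /and3P[]]].
rewrite mulSn.
pose F := \bigcup_(y in [set y | r u y && r v y]) [set x in A | r x y].
apply: leq_trans (_ : #|F :|: [set x in U | [exists y, [&& r u y, r x y & has (r^~ y) s]]]| <= _).
  apply: subset_leq_card; apply/subsetP => x; rewrite !inE.
  case/andP=> xU /existsP[y /and3P[ruy rxy /orP[rvy|hs]]]; apply/orP; [left|right].
    by apply/bigcupP; exists y; rewrite inE ?ruy ?rvy // (subsetP UA).
  by rewrite xU; apply/existsP; exists y; rewrite ruy rxy.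
apply: leq_trans (leq_card_setU _ _) _; apply: leq_add; last exact: IHs.
apply: leq_trans (_ : \sum_(y in [set y | r u y && r v y]) D <= _).
  apply: (big_ind2 (fun (C : {set X}) k => #|C| <= k)) => [|C k C' k' Ck C'k'|y _ //].
    by rewrite cards0.
  by apply: leq_trans (leq_card_setU _ _) _; apply: leq_add.
by rewrite sum_nat_const leq_mul //; case/and3P: uv => _ _ /ltnW.
Qed.

(** Each round appends a vertex to [s] and shrinks the candidate set [U] by a factor of at most
    [M / d ^ 2]. After [T.+1] rounds [U] is nonempty, and any candidate is the last branch vertex.
    The double negation arises because every round assumes that no copy exists. *)
Lemma subdiv_of_regular (X Y : finType) (T : nat) (r : X -> Y -> bool)
    (A : {set X}) (B : {set Y}) (d b D : nat) :
  let t := T.+2 in let q := #|{: Kedge t}| in let M := 8 * t * q * b in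
  (forall x y, r x y -> y \in B) -> #|B| <= b ->
  (forall x, x \in A -> d <= #|[set y | r x y]|) ->
  (forall y, #|[set x in A | r x y]| <= D) ->
  0 < #|A| -> 0 < d ->
  2 * t * b <= #|A| * d ->
  2 * t * b * M ^ T <= #|A| * d ^ (2 * T + 1) ->
  t * q * D * M ^ T.+1 <= #|A| * d ^ (2 * T + 2) ->
  ~ ~ subdiv_in t r.
Proof.
move=> t q M rB Bb degA degD A0 d0 H0 H1 H2 Hfree.
(* The guaranteed surviving proportion [d ^ 2 / M] is at most 1, so the size bound after [i <= T]
   rounds implies the one for [T] rounds, in terms of which the hypotheses are stated. *)
have dM : d ^ 2 <= M.
  have [u uA Hu] := light_neighbour Hfree rB Bb degA A0 H0.
  have le : #|[set x in A | light t r u x]| <= #|A|.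
    by apply: subset_leq_card; apply/subsetP => x; rewrite inE => /andP[].
  rewrite -/q in Hu.
  rewrite -(leq_pmul2l A0); apply: leq_trans Hu _; rewrite mulnC.
  by apply: leq_mul => //; rewrite /M -!mulnA leq_mul2r orbT.
have M0 : 0 < M by apply: leq_trans dM; rewrite expn_gt0 d0.
suff [s [U [ss UA cU HU]]] : exists s (U : {set X}), [/\ size s = T.+1, U \subset A,
    forall x, x \in U -> clean t r (x :: s) & #|A| * d ^ (2 * T.+1) <= M ^ T.+1 * #|U|].
  have : 0 < M ^ T.+1 * #|U| by apply: leq_trans HU; rewrite muln_gt0 A0 expn_gt0 d0.
  rewrite muln_gt0 => /andP[_ /card_gt0P[x /cU cx]].
  by apply: Hfree; apply: clean_subdiv cx; rewrite /= ss.
(* The number of rounds becomes the induction variable, while the upper bound [T.+1] stays fixed. *)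
have : T.+1 <= T.+1 by [].
elim: {1 3 4 5}T.+1 => [_|i IHi iT].
  exists [::], A; split=> //; last by rewrite muln0 !expn0 muln1 mul1n.
  by move=> x _; rewrite /clean /=; apply/forallP => y; case: (r x y).
have [s [U [ss UA cU HU]]] := IHi (ltnW iT).
have HUT : #|A| * d ^ (2 * T) <= M ^ T * #|U|.
  have -> : d ^ (2 * T) = d ^ (2 * i) * (d ^ 2) ^ (T - i).
    by rewrite -expnM -expnD; congr (d ^ _); lia.
  have -> : M ^ T = M ^ i * M ^ (T - i) by rewrite -expnD subnKC.
  rewrite mulnA [X in _ <= X]mulnAC; apply: leq_mul => //.
  by case: (T - i) => // k; rewrite leq_exp2r.
have U0 : 0 < #|U|.
  have : 0 < M ^ i * #|U| by apply: leq_trans HU; rewrite muln_gt0 A0 expn_gt0 d0.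
  by rewrite muln_gt0 => /andP[].
have MT0 : 0 < M ^ T by rewrite expn_gt0 M0.
have Ub : 2 * t * b <= #|U| * d.
  rewrite -(leq_pmul2l MT0) mulnC; apply: leq_trans H1 _.
  by rewrite addn1 expnSr [X in X <= _]mulnA [X in _ <= X]mulnA leq_mul2r HUT orbT.
have UD : t * q * D * M <= #|U| * d ^ 2.
  rewrite -(leq_pmul2l MT0) mulnC -mulnA -expnS; apply: leq_trans H2 _.
  have -> : d ^ (2 * T + 2) = d ^ (2 * T) * d ^ 2 by exact: expnD.
  by rewrite [X in X <= _]mulnA [X in _ <= X]mulnA leq_mul2r HUT orbT.
have degU x : x \in U -> d <= #|[set y | r x y]| by move=> /(subsetP UA)/degA.
have [u uU Hu] := light_neighbour Hfree rB Bb degU U0 Ub.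
have cu := cU u uU.
pose L := [set x in U | light t r u x].
pose Ex := [set x in U | [exists y, [&& r u y, r x y & has (r^~ y) s]]].
have us : all (light t r u) s by move: cu; rewrite /clean /= => /andP[/andP[]].
have cEx : #|Ex| <= t * q * D.
  apply: leq_trans (card_excluded UA degD us) _.
  by rewrite ss -/q mulnA -!mulnA leq_mul2r; apply/orP; right; rewrite /t; lia.
exists (u :: s), (L :\: Ex); split.
- by rewrite /= ss.
- by apply: subset_trans UA; apply/subsetP => x; rewrite !inE => /and3P[].
- move=> x; rewrite inE => /andP[xE]; rewrite inE => /andP[xU lx].
  apply: clean_cons2 => //; [exact: cU | by rewrite lightC |].
  move=> v y vs ruy rvy; apply/negP => rxy; case/negP: xE; rewrite inE xU /=.
  by apply/existsP; exists y; rewrite ruy rxy; apply/hasP; exists v.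
- have LE : #|L| <= #|L :\: Ex| + t * q * D.
    by rewrite cardsD; have := subset_leq_card (subsetIr L Ex); lia.
  have step : #|U| * d ^ 2 <= M * #|L :\: Ex|.
    rewrite -/q -/L in Hu.
    (* The 8 in [M] is twice the 4 of [light_neighbour]; the spare half pays for [Ex]. *)
    have HuM : 2 * (#|U| * d ^ 2) <= M * #|L| by rewrite /M; lia.
    have := leq_mul (leqnn M) LE; rewrite mulnDr; move: UD HuM; lia.
  rewrite mulnS expnD mulnCA -mulnA.
  have := leq_mul HU (leqnn (d ^ 2)).
  have := leq_mul (leqnn (M ^ i)) step.
  rewrite (expnSr M i) !mulnA; move=> h1 h2; apply: leq_trans h1.
  by move: h2; rewrite -!mulnA; lia.
Qed.

(** * Regularising the degrees: numerical conditions and the extremal subset *)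

(** Meant for [a = #|A|], [b = #|B|], [b' = #|S|], [e] the number of edges at the extremal [S], and
    [a * d] all edges. Squaring the goal and multiplying by [b ^ (T + 1)] lets the extremality of
    [S] enter as an integral power; the surplus of [b'] is bounded by [b], then by [a]. *)
Lemma edge_power_bound1 (T a b b' d e C : nat) :
  0 < b -> b' <= b -> b <= a -> (a * d) ^ 4 * b' <= e ^ 4 * b ->
  C * b ^ T <= d ^ (2 * T + 1) ->
  C * (d * a ^ (2 * T + 1) * b' ^ (T + 1)) <= e ^ (2 * T + 2).
Proof.
move=> b0 b'b ba Hmax HC.
rewrite -(@leq_exp2r _ _ 2) // -(@leq_pmul2r (b ^ (T + 1))) ?expn_gt0 ?b0 //.
have -> : (e ^ (2 * T + 2)) ^ 2 * b ^ (T + 1) = (e ^ 4 * b) ^ (T + 1).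
  by rewrite expnMn -!expnM; congr (e ^ _ * _); lia.
apply: leq_trans (_ : ((a * d) ^ 4 * b') ^ (T + 1) <= _); last first.
  by rewrite leq_exp2r // addn1.
have -> : ((a * d) ^ 4 * b') ^ (T + 1) =
    (a ^ (2 * T + 1) * a * (d ^ (2 * T + 1) * d)) ^ 2 * b' ^ (T + 1).
  rewrite -!expnSr -expnMn -expnM expnMn -expnM; congr ((_ * _) ^ _ * _); lia.
have -> : b ^ (T + 1) = b * b ^ T by rewrite addn1 expnS.
have le : b' ^ (T + 1) <= b * b ^ T.
  by rewrite -expnS addn1 leq_exp2r.
move: le HC.
move: (a ^ (2 * T + 1)) (d ^ (2 * T + 1)) (b' ^ (T + 1)) (b ^ T) => al pi be' be le HC.
have h1 : C ^ 2 * be' * (b * be) <= (a * pi) ^ 2.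
  apply: leq_trans (_ : (b * (C * be)) ^ 2 <= _); last first.
    by rewrite leq_exp2r //; apply: leq_mul.
  apply: leq_trans (_ : C ^ 2 * (b * be) * (b * be) <= _).
    by rewrite leq_mul2r leq_mul2l le !orbT.
  by rewrite !expnS !expn0; lia.
apply: leq_trans (_ : (al * d) ^ 2 * be' * (C ^ 2 * be' * (b * be)) <= _).
  by rewrite !expnS !expn0; lia.
apply: leq_trans (leq_mul (leqnn _) h1) _.
by rewrite !expnS !expn0; lia.
Qed.

(** Same method, one factor [b'] traded for [a]. The passage to [S] costs a factor
    [(b' / b) ^ ((T + 1) / 2)], which [b' ^ T] absorbs because [0 < T]; this is where the exponent 4
    is large enough. *)
Lemma edge_power_bound2 (T a b b' d e C : nat) :
  0 < T -> 0 < b -> b' <= b -> (a * d) ^ 4 * b' <= e ^ 4 * b ->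
  C * b ^ T <= d ^ (2 * T + 1) ->
  C * (d * a ^ (2 * T + 2) * b' ^ T) <= e ^ (2 * T + 2).
Proof.
case: T => // S _ b0 b'b Hmax HC.
rewrite -(@leq_exp2r _ _ 2) // -(@leq_pmul2r (b ^ (S.+1 + 1))) ?expn_gt0 ?b0 //.
have -> : (e ^ (2 * S.+1 + 2)) ^ 2 * b ^ (S.+1 + 1) = (e ^ 4 * b) ^ (S.+1 + 1).
  by rewrite expnMn -!expnM; congr (e ^ _ * _); lia.
apply: leq_trans (_ : ((a * d) ^ 4 * b') ^ (S.+1 + 1) <= _); last first.
  by rewrite leq_exp2r // addn1.
have -> : ((a * d) ^ 4 * b') ^ (S.+1 + 1) =
    (a ^ (2 * S.+1 + 2) * (d ^ (2 * S.+1 + 1) * d)) ^ 2 * (b' ^ S.+1 * b').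
  rewrite -!expnSr [LHS]expnMn -[((a * d) ^ 4) ^ _]expnM (expnMn a d) [in RHS]expnMn -!expnM.
  by congr (_ ^ _ * _ ^ _ * _ ^ _); lia.
have -> : b ^ (S.+1 + 1) = b * b ^ S.+1 by rewrite addn1 expnS.
have le : b * b' ^ S <= b ^ S.+1.
  rewrite expnS leq_mul2l; apply/orP; right.
  by case: (S) => // k; rewrite leq_exp2r.
move: le HC; rewrite (expnS b').
move: (a ^ (2 * S.+1 + 2)) (d ^ (2 * S.+1 + 1)) (b' ^ S) (b ^ S.+1) => al pi be' be le HC.
have h1 : C ^ 2 * (b * be') * be <= pi ^ 2.
  apply: leq_trans (_ : (C * be) ^ 2 <= _); last by rewrite leq_exp2r.
  apply: leq_trans (_ : C ^ 2 * be * be <= _).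
    by rewrite leq_mul2r leq_mul2l le !orbT.
  by rewrite !expnS !expn0; lia.
apply: leq_trans (_ : (al * d) ^ 2 * (be' * b' * b') * (C ^ 2 * (b * be') * be) <= _).
  by rewrite !expnS !expn0; lia.
apply: leq_trans (leq_mul (leqnn _) h1) _.
by rewrite !expnS !expn0; lia.
Qed.

(** One summand for each conclusion of [regular_conditions], in that order. *)
Definition threshold (t q T : nat) : nat :=
  32 * t + 2 * t * (8 * t * q) ^ T * 4 ^ (2 * T + 2)
  + 16 * t * q * (8 * t * q) ^ T.+1 * 4 ^ (2 * T + 3).

(** Only [e] bounds [a'] and [d'] from below, so each condition is scaled into a lower bound on a
    power of [e], which the edge power bounds supply. *)
Lemma regular_conditions (t q T a b a' b' d d' D e : nat) :
  0 < T -> 0 < a -> 0 < d -> 0 < b' -> b' <= b -> b <= a ->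
  e <= 4 * (a' * d) -> e <= 4 * a * d' -> b' * D <= 16 * e ->
  (a * d) ^ 4 * b' <= e ^ 4 * b ->
  threshold t q T <= d -> threshold t q T * b ^ T <= d ^ (2 * T + 1) ->
  let M := 8 * t * q * b' in
  [/\ 2 * t * b' <= a' * d',
      2 * t * b' * M ^ T <= a' * d' ^ (2 * T + 1) &
      t * q * D * M ^ T.+1 <= a' * d' ^ (2 * T + 2)].
Proof.
move=> T0 a0 d0 b'0 b'b ba Ha' Hd' HD Hmax Cd HC M.
have b0 : 0 < b by apply: leq_trans b'b.
pose C0 := 32 * t.
pose C1 := 2 * t * (8 * t * q) ^ T * 4 ^ (2 * T + 2).
pose C2 := 16 * t * q * (8 * t * q) ^ T.+1 * 4 ^ (2 * T + 3).
have EC : threshold t q T = C0 + C1 + C2 by [].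
have HC1 : C1 * b ^ T <= d ^ (2 * T + 1).
  by apply: leq_trans HC; rewrite leq_mul2r EC; apply/orP; right; lia.
have HC2 : C2 * b ^ T <= d ^ (2 * T + 1).
  by apply: leq_trans HC; rewrite leq_mul2r EC; apply/orP; right; lia.
have HC0 : C0 * b ^ 0 <= d ^ (2 * 0 + 1).
  by rewrite expn0 expn1 muln1; apply: leq_trans Cd; rewrite EC; lia.
have B0 := edge_power_bound1 b0 b'b ba Hmax HC0.
have B1 := edge_power_bound1 b0 b'b ba Hmax HC1.
have B2 := edge_power_bound2 T0 b0 b'b Hmax HC2.
(* Combines [a' >= e / (4 * d)] with [k] copies of [d' >= e / (4 * a)]. *)
have scale k : e ^ k.+1 <= 4 * d * (4 * a) ^ k * (a' * d' ^ k).
  rewrite expnS.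
  have -> : 4 * d * (4 * a) ^ k * (a' * d' ^ k) = 4 * (a' * d) * (4 * a * d') ^ k.
    rewrite (expnMn (4 * a)); move: ((4 * a) ^ k) (d' ^ k) => x y; lia.
  by apply: leq_mul => //; case: k => // k; rewrite leq_exp2r.
have pos k : 0 < 4 * d * (4 * a) ^ k by rewrite !muln_gt0 expn_gt0 muln_gt0 d0 a0.
split.
- rewrite -(leq_pmul2l (pos 1)) -[d' in X in _ <= X](expn1 d').
  apply: leq_trans (scale 1); apply: leq_trans B0.
  rewrite /C0 ?muln0 ?add0n ?expn1; lia.
- rewrite -(leq_pmul2l (pos (2 * T + 1))).
  apply: leq_trans (scale _); rewrite -addnS; apply: leq_trans B1.
  have E4 : 4 ^ (2 * T + 2) = 4 ^ (2 * T + 1) * 4 by rewrite -expnSr addnS.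
  have Eb : b' ^ (T + 1) = b' * b' ^ T by rewrite addn1 expnS.
  rewrite /C1 /M E4 Eb (expnMn 4) (expnMn (8 * t * q)).
  move: (4 ^ (2 * T + 1)) (a ^ (2 * T + 1)) ((8 * t * q) ^ T) (b' ^ T) => x y z w; lia.
- rewrite -(leq_pmul2l (pos (2 * T + 2))).
  (* One factor [e] is set aside to pay for [D] through [b' * D <= 16 * e]. *)
  apply: leq_trans (scale _); rewrite (expnS e).
  apply: leq_trans (leq_mul (leqnn e) B2).
  have E4 : 4 ^ (2 * T + 3) = 4 ^ (2 * T + 2) * 4 by rewrite -expnSr addnS.
  rewrite /C2 /M E4 (expnMn 4) (expnMn (8 * t * q)) (expnS b').
  move: (4 ^ (2 * T + 2)) (a ^ (2 * T + 2)) ((8 * t * q) ^ T.+1) (b' ^ T) => x y z w.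
  have := leq_mul (leqnn (4 * d * x * y * t * q * z * w)) HD; lia.
Qed.

(* The extremal [S] stands in for a dyadic decomposition by degree: it is the
   reason why few edges meet the vertices of degree much above average. *)
Lemma max_edge_density (Y : finType) (w : Y -> nat) (B : {set Y}) (k : nat) :
  B != set0 ->
  exists S : {set Y}, [/\ S \subset B, S != set0 &
    forall S' : {set Y}, S' \subset B ->
      (\sum_(y in S') w y) ^ k.+1 * #|S| <= (\sum_(y in S) w y) ^ k.+1 * #|S'|].
Proof.
move=> B0; set b := #|B|.
pose P (S : {set Y}) := (S \subset B) && (S != set0).
(* The ratio is multiplied by [b!], which makes it integral since [#|S| <= b]. *)
pose m (S : {set Y}) := (\sum_(y in S) w y) ^ k.+1 * (b`! %/ #|S|).
have PB : P B by rewrite /P subxx.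
case: (@arg_maxnP _ B P m PB) => S /andP[SB S0] Smax.
exists S; split=> // S' S'B.
have [->|S'0] := eqVneq S' set0; first by rewrite big_set0 exp0n // mul0n.
have dv (V : {set Y}) : V \subset B -> V != set0 -> b`! %/ #|V| * #|V| = b`!.
  move=> VB V0; apply: divnK; apply: dvdn_fact.
  by rewrite card_gt0 V0 subset_leq_card.
have := Smax S'; rewrite /P S'B S'0 => /(_ isT); rewrite /m => le.
rewrite -(leq_pmul2r (fact_gt0 b)).
have := leq_mul le (leqnn (#|S| * #|S'|)).
move: (dv S' S'B S'0) (dv S SB S0).
move: (b`! %/ _) (b`! %/ _) => p p' Ep Ep'; rewrite -{1}Ep -Ep'; lia.
Qed.

(** Passing to the extremal [S], dropping its vertices of large degree and then the vertices of [A]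
    with few remaining neighbours yields the input of [subdiv_of_regular]. *)
Lemma subdiv_of_left_regular (X Y : finType) (T : nat) (r : X -> Y -> bool)
    (A : {set X}) (B : {set Y}) (d : nat) :
  let K := threshold T.+2 #|{: Kedge T.+2}| T in
  0 < T -> 0 < d -> 0 < #|A| -> #|B| <= #|A| ->
  (forall x y, r x y -> y \in B) ->
  (forall x, x \in A -> #|[set y | r x y]| = d) ->
  K <= d -> K * #|B| ^ T <= d ^ (2 * T + 1) ->
  ~ ~ subdiv_in T.+2 r.
Proof.
move=> K T0 d0 A0 BA rB degA Kd KB.
pose deg y := #|[set x in A | r x y]|.
have sum_deg (S : {set Y}) :
    \sum_(y in S) deg y = \sum_(x in A) #|[set y in S | r x y]|.
  rewrite /deg (eq_bigr (fun y => \sum_(x in A) r x y)); last first.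
    by move=> y _; rewrite -sum1dep_card big_mkcondr.
  rewrite exchange_big; apply: eq_bigr => x _.
  by rewrite -sum1dep_card [in RHS]big_mkcondr.
have eB : \sum_(y in B) deg y = #|A| * d.
  rewrite sum_deg -sum_nat_const; apply: eq_bigr => x xA; rewrite -(degA x xA).
  by apply: eq_card => y; rewrite !inE; case rxy: (r x y); rewrite ?andbF ?(rB _ _ rxy).
have B0 : B != set0.
  apply/eqP => B0; move: eB; rewrite B0 big_set0 => /esym/eqP.
  by rewrite gtn_eqF // muln_gt0 A0.
have [S [SB S0 Smax]] := max_edge_density deg 3 B0.
have b'0 : 0 < #|S| by rewrite card_gt0.
set e := \sum_(y in S) deg y in Smax.
have HB := Smax B (subxx _); rewrite eB in HB.
have e0 : 0 < e.
  rewrite lt0n; apply/negP => /eqP E.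
  by move: HB; rewrite E exp0n // mul0n leqNgt muln_gt0 expn_gt0 muln_gt0 A0 d0 b'0.
(* Degree above 16 times the average gives [16 * #|H| <= #|S|]; as 16 is [2 ^ 4], extremality leaves
   [H] at most half of the edges. *)
pose H := [set y in S | 16 * e < deg y * #|S|].
have HS : H \subset S by apply/subsetP => y; rewrite inE => /andP[].
have Ee : e = \sum_(y in H) deg y + \sum_(y in S :\: H) deg y.
  by rewrite /e [LHS](big_setID H) (setIidPr HS).
have eH : 2 * \sum_(y in H) deg y <= e.
  have cH : 16 * #|H| <= #|S|.
    have : #|H| * (16 * e) <= e * #|S|.
      apply: leq_trans (_ : (\sum_(y in H) deg y) * #|S| <= _).
        rewrite big_distrl -sum_nat_const /=; apply: leq_sum => y.
        by rewrite inE => /andP[_ /ltnW].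
      by rewrite leq_mul2r Ee leq_addr orbT.
    by move=> h; rewrite -(leq_pmul2r e0); lia.
  rewrite -(@leq_exp2r _ _ 4) // -(leq_pmul2r b'0).
  have := Smax H (subset_trans HS SB).
  have -> : (2 * \sum_(y in H) deg y) ^ 4 = 16 * (\sum_(y in H) deg y) ^ 4.
    by rewrite expnMn.
  have := leq_mul (leqnn (e ^ 4)) cH; lia.
pose B3 := S :\: H.
have eB3 : e <= 2 * \sum_(y in B3) deg y.
  by move: eH; rewrite /B3; lia.
(* At least [e / 2] edges go to [B3], and vertices outside [A'] carry at most [e / 4] of them; the
   rest meet [A'], at most [d] per vertex. *)
pose A' := [set x in A | e <= 4 * #|A| * #|[set y in B3 | r x y]|].
have A'A : A' \subset A by apply/subsetP => y; rewrite inE => /andP[].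
have eA' : e <= 4 * (#|A'| * d).
  have h : 4 * #|A| * \sum_(y in B3) deg y <= #|A| * (4 * (#|A'| * d)) + #|A| * e.
    rewrite sum_deg (big_setID A') (setIidPr A'A) mulnDr; apply: leq_add.
      rewrite [4 * #|A|]mulnC -mulnA leq_mul2l leq_mul2l -sum_nat_const; apply/orP; right.
      apply: leq_sum => x /(subsetP A'A) xA; rewrite -(degA x xA).
      by apply: subset_leq_card; apply/subsetP => y; rewrite !inE => /andP[].
    apply: leq_trans (_ : #|A :\: A'| * e <= _); last first.
      by rewrite leq_mul2r subset_leq_card ?subsetDl ?orbT.
    rewrite big_distrr -sum_nat_const /=; apply: leq_sum => x.
    rewrite !inE => /andP[/negP nA xA]; rewrite leqNgt; apply/negP => /ltnW lt.
    by apply: nA; rewrite xA.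
  by rewrite -(leq_pmul2l A0); nia.
(* [d'] is [e / (4 * #|A|)] rounded up; its minimality makes it a lower bound for the degrees on
   [A']. *)
have [d' Hd' mind'] : exists2 d', e <= 4 * #|A| * d' &
    forall k, e <= 4 * #|A| * k -> d' <= k.
  have ex0 : exists k, e <= 4 * #|A| * k.
    by exists e; rewrite leq_pmull // muln_gt0 A0.
  by case: (ex_minnP ex0) => d'; exists d'.
pose D := 16 * e %/ #|S|.
have HD : #|S| * D <= 16 * e by rewrite mulnC leq_trunc_div.
have [C0 C1 C2] := regular_conditions T0 A0 d0 b'0 (subset_leq_card SB) BA eA' Hd' HD HB Kd KB.
move=> Hfree.
apply: (@subdiv_of_regular X Y T (fun x y => r x y && (y \in B3)) A' B3 d' #|S| D) C0 C1 C2 _.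
- by move=> x y /andP[].
- by rewrite subset_leq_card // subsetDl.
- move=> x; rewrite inE => /andP[_ /mind'] /leq_trans; apply.
  by apply: subset_leq_card; apply/subsetP => y; rewrite !inE andbC.
- move=> y; case yB: (y \in B3); last first.
    rewrite [X in #|pred_of_set X|](_ : _ = set0) ?cards0 //.
    by apply/setP => x; rewrite !inE !andbF.
  move: yB; rewrite !inE => /andP[/[swap] yS]; rewrite yS /= -leqNgt => le.
  rewrite /D leq_divRL //; apply: leq_trans le; rewrite leq_mul2r; apply/orP; right.
  by apply: subset_leq_card; apply/subsetP => x; rewrite !inE => /and3P[/andP[-> _] -> _].
- by move: e0 eA'; lia.
- by move: e0 Hd'; lia.
- case=> u [w [uinj winj ruw]]; apply: Hfree; exists u, w; split=> // i k ik.
  by have /andP[] := ruw i k ik.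
Qed.

(** Keeping just [d] neighbours of every vertex of [A] reduces to the case of exact degree [d]. *)
Lemma subdiv_of_min_degree (X Y : finType) (T : nat) (r : X -> Y -> bool)
    (A : {set X}) (B : {set Y}) (d : nat) :
  let K := threshold T.+2 #|{: Kedge T.+2}| T in
  0 < T -> 0 < d -> 0 < #|A| -> #|B| <= #|A| ->
  (forall x, x \in A -> d <= #|[set y in B | r x y]|) ->
  K <= d -> K * #|B| ^ T <= d ^ (2 * T + 1) ->
  ~ ~ subdiv_in T.+2 (fun x y => [&& x \in A, y \in B & r x y]).
Proof.
move=> K T0 d0 A0 BA degA Kd KB Hfree.
pose N x := [set y in B | r x y].
pose r' x y := (x \in A) && (y \in take d (enum (N x))).
have r'P x y : r' x y -> [&& x \in A, y \in B & r x y].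
  by case/andP=> -> /mem_take; rewrite mem_enum inE.
apply: (@subdiv_of_left_regular X Y T r' A B d T0 d0 A0 BA _ _ Kd KB).
- by move=> x y /r'P/and3P[].
- move=> x xA.
  have -> : [set y | r' x y] = [set y in take d (enum (N x))].
    by apply/setP => y; rewrite !inE /r' xA.
  rewrite cardsE (card_uniqP _) ?take_uniq ?enum_uniq // size_takel //.
  by rewrite -cardE degA.
- case=> u [w [uinj winj ruw]]; apply: Hfree; exists u, w; split=> // i k ik.
  exact: r'P (ruw i k ik).
Qed.

(** * From graphs to bipartite graphs of large minimum degree *)

Lemma adjC n (E : {set {set 'I_n}}) : symmetric (adj E).
Proof. by move=> x y; rewrite /adj eq_sym setUC. Qed.

(** Take a smallest [S] spanning more than [k * #|S|] edges: deleting a vertex of degree at most [k]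
    would preserve this. *)
Lemma min_degree_subgraph (n k : nat) (E : {set {set 'I_n}}) :
  simple_graph E -> k * n < #|E| ->
  exists2 S : {set 'I_n}, S != set0 &
    forall v, v \in S -> k < #|[set w in S | adj E v w]|.
Proof.
move=> /forall_inP Esimple kE.
pose ES (S : {set 'I_n}) := [set e in E | e \subset S].
have PT : k * #|[set: 'I_n]| < #|ES setT|.
  rewrite cardsT card_ord; apply: leq_trans kE _.
  by apply: subset_leq_card; apply/subsetP => e eE; rewrite inE eE subsetT.
case: (@arg_minnP _ setT (fun S => k * #|S| < #|ES S|) (fun S => #|S|) PT) => S HS Smin.
exists S.
  apply/eqP => S0; move: HS; rewrite S0 cards0 muln0 => /card_gt0P[e].
  rewrite inE subset0 => /andP[/Esimple e2 /eqP e0].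
  by rewrite e0 cards0 in e2.
move=> v vS; have Sv : #|S| = #|S :\ v|.+1 by rewrite (cardsD1 v) vS.
have nv : #|ES (S :\ v)| <= k * #|S :\ v|.
  by rewrite leqNgt; apply/negP => /Smin; rewrite Sv ltnn.
have le : #|ES S| <= #|ES (S :\ v)| + #|[set w in S | adj E v w]|.
  apply: leq_trans (_ : #|ES (S :\ v) :|: [set [set v; w] | w in [set w in S | adj E v w]]| <= _).
    apply: subset_leq_card; apply/subsetP => e; rewrite !inE => /andP[eE eS].
    rewrite eE /= subsetD1 eS /=; case ve: (v \in e) => //=.
    have /cards2P[a [b [ab Ee]]] := Esimple e eE.
    have [w vw Ew] : exists2 w, v != w & e = [set v; w].
      move: ve; rewrite Ee !inE => /orP[]/eqP->; first by exists b.
      by exists a; [rewrite eq_sym | rewrite setUC].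
    apply/imsetP; exists w => //; rewrite inE /adj vw -Ew eE.
    by rewrite (subsetP eS) // Ew !inE eqxx orbT.
  apply: leq_trans (leq_card_setU _ _) _.
  by rewrite leq_add2l leq_imset_card.
by move: HS; rewrite Sv mulnS; lia.
Qed.

(** In a cut with the most crossing edges, moving one vertex across gains nothing, so at least half
    of its edges cross. *)
Lemma max_cut (V : finType) (e : rel V) (S : {set V}) :
  symmetric e -> irreflexive e ->
  exists2 A : {set V}, A \subset S &
    (forall x, x \in A -> #|[set y in S | e x y]| <= 2 * #|[set y in S :\: A | e x y]|) /\
    (forall x, x \in S :\: A -> #|[set y in S | e x y]| <= 2 * #|[set y in A | e x y]|).
Proof.
move=> eC e0.
pose c (A : {set V}) := \sum_(x in A) \sum_(y in S :\: A) e x y.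
have degE (x : V) (Q : {set V}) : #|[set y in Q | e x y]| = \sum_(y in Q) e x y.
  by rewrite -sum1dep_card big_mkcondr.
have flip (A : {set V}) : A \subset S -> (forall A' : {set V}, A' \subset S -> c A' <= c A) ->
    forall x, x \in A -> #|[set y in S | e x y]| <= 2 * #|[set y in S :\: A | e x y]|.
  move=> AS Amax x xA.
  have := Amax (A :\ x) (subset_trans (subD1set _ _) AS).
  have xS := subsetP AS _ xA.
  have SAx : S :\: (A :\ x) = x |: (S :\: A).
    by apply/setP => y; rewrite !inE; case: eqP => [->|_] //=; rewrite xS.
  have xSA : x \notin S :\: A by rewrite inE xA.
  rewrite /c (big_setD1 x xA) /= SAx.
  rewrite (eq_bigr (fun z => e z x + \sum_(y in S :\: A) e z y)); last first.
    by move=> z _; rewrite big_setU1.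
  rewrite big_split leq_add2r /= => le.
  rewrite !degE (big_setID A) (setIidPr AS) (big_setD1 x xA) /= e0 add0n.
  rewrite mul2n -addnn leq_add2r; apply: leq_trans le.
  by apply: leq_sum => z _; rewrite eC.
have P0 : (fun A : {set V} => A \subset S) set0 by rewrite sub0set.
case: (@arg_maxnP _ set0 (fun A : {set V} => A \subset S) c P0) => A AS Amax.
have AC : S :\: (S :\: A) = A by rewrite setDDr setDv set0U; apply/setIidPr.
exists A => //; split; first exact: flip.
(* The cut size is unchanged when the sides are swapped, so the complement is optimal too. *)
have := flip (S :\: A) (subsetDl _ _); rewrite AC; apply=> A' A'S.
rewrite [c (S :\: A)](_ : _ = c A); first exact: Amax.
rewrite /c AC exchange_big; apply: eq_bigr => x _; apply: eq_bigr => y _.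
by rewrite eC.
Qed.

Lemma contains_subdivision (n T : nat) (E : {set {set 'I_n}}) (A B : {set 'I_n}) :
  [disjoint A & B] ->
  subdiv_in T.+2 (fun x y => [&& x \in A, y \in B & adj E x y]) ->
  contains_sub (@Hrel T.+2) E.
Proof.
move=> AB [u [w [uinj winj ruw]]].
(* As [T.+2 >= 2], every [i] lies on an edge of the complete graph, and adjacency to its midpoint
   puts [u i] in [A]. *)
have uA i : u i \in A.
  pose j : 'I_T.+2 := if i == ord0 then ord_max else ord0.
  have ij : i != j.
    by rewrite /j; case: ifP => [/eqP->|->].
  have e2 : #|[set i; j]| == 2 by rewrite cards2 ij.
  have := ruw i (exist _ [set i; j] e2).
  rewrite /= !inE eqxx => /(_ isT) /and3P[]; exact.

have wB (e : Kedge T.+2) : w e \in B.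
  have [i [j [_ Ee]]] := KedgeP e.
  by have := ruw i e; rewrite Ee !inE eqxx => /(_ isT) /and3P[].
have uw i e : u i <> w e.
  by move=> Euw; have := disjointFr AB (uA i); rewrite Euw wB.
apply/existsP; exists [ffun v : Hvert T.+2 => match v with inl i => u i | inr e => w e end].
apply/andP; split.
  apply/injectiveP => -[i|e] [j|e']; rewrite !ffunE.
  - by move/uinj->.
  - by move/uw.
  - by move/esym/uw.
  - by move/winj->.
apply/forallP => -[i|e]; apply/forallP => -[j|e']; rewrite !ffunE //=;
  apply/implyP => h.
- by case/and3P: (ruw _ _ h).
- by rewrite adjC; case/and3P: (ruw _ _ h).
Qed.

(** More edges would give a subgraph of minimum degree above [2 * d], hence a cut with all crossing
    degrees at least [d]. *)
Lemma edges_bound (n T d : nat) (E : {set {set 'I_n}}) :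
  let K := threshold T.+2 #|{: Kedge T.+2}| T in
  0 < T -> 0 < d -> K <= d -> K * n ^ T <= d ^ (2 * T + 1) ->
  simple_graph E -> ~~ contains_sub (@Hrel T.+2) E -> #|E| <= 2 * d * n.
Proof.
move=> K T0 d0 Kd Kn Esimple Hfree; rewrite leqNgt; apply/negP => lt.
have [S S0 degS] := min_degree_subgraph Esimple lt.
have irr : irreflexive (adj E) by move=> x; rewrite /adj eqxx.
have [A AS [degA degB]] := max_cut S (@adjC n E) irr.
(* Stated for either orientation, since the larger side must hold the branch vertices. *)
have side (P Q : {set 'I_n}) : [disjoint P & Q] -> 0 < #|P| + #|Q| -> #|Q| <= #|P| ->
    P \subset S ->
    (forall x, x \in P -> #|[set y in S | adj E x y]| <= 2 * #|[set y in Q | adj E x y]|) ->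
    False.
  move=> PQ P0 QP PS deg.
  have P1 : 0 < #|P| by move: P0 QP; case: #|P| => //; case: #|Q|.
  have dP x : x \in P -> d <= #|[set y in Q | adj E x y]|.
    by move=> xP; have := degS x (subsetP PS _ xP); have := deg x xP; lia.
  have KQ : K * #|Q| ^ T <= d ^ (2 * T + 1).
    apply: leq_trans Kn; rewrite leq_mul2l leq_exp2r //; apply/orP; right.
    by rewrite -[n in _ <= n]card_ord max_card.
  apply: (subdiv_of_min_degree T0 d0 P1 QP dP Kd KQ).
  by move/(contains_subdivision PQ); apply/negP.
have dis : [disjoint A & S :\: A].
  by rewrite -setI_eq0; apply/eqP/setP => x; rewrite !inE; case: (x \in A).
have cAS : 0 < #|A| + #|S :\: A|.
  by have := cardsID A S; rewrite (setIidPr AS) => ->; rewrite card_gt0.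
have [le|/ltnW le] := leqP #|S :\: A| #|A|.
  exact: (side A (S :\: A)).
apply: (side (S :\: A) A) => //; [by rewrite disjoint_sym | by rewrite addnC | exact: subsetDl].
Qed.

(** * Real exponents and the choice of [d] *)

Lemma INR_expn (m k : nat) : INR (m ^ k) = pow (INR m) k.
Proof.
by elim: k => [|k IHk] //=; rewrite expnS mult_INR IHk.
Qed.

Theorem theorem3 :
  forall t : nat, (3 <= t)%N ->
  exists C : R, forall n : nat, (0 < n)%N ->
    (INR (ex (@Hrel t) n) <=
       C * Rpower (INR n) (1 + INR (t - 2) / INR (2 * t - 3)))%R.
Proof.
move=> [|[|T]] // T0.
have -> : T.+2 - 2 = T by rewrite !subSS subn0.
have -> : 2 * T.+2 - 3 = 2 * T + 1 by rewrite !mul2n !doubleS !subSS subn0 addn1.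
set K := threshold T.+2 #|{: Kedge T.+2}| T.
have K1 : (1 <= INR K)%R.
  by apply: (le_INR 1); rewrite /K /threshold; lia.
exists (2 * (INR K + 1))%R => n n0.
have n1 : (1 <= INR n)%R by apply: (le_INR 1); lia.
have T1 : (0 < INR (2 * T + 1))%R by apply: lt_0_INR; lia.
pose eps := (INR T / INR (2 * T + 1))%R.
(* [x] is the intended degree up to a constant: its power [2 * T + 1] is [n ^ T]. *)
pose x := Rpower (INR n) eps.
have eps0 : (0 <= eps)%R.
  by apply: Rmult_le_pos; [exact: pos_INR | apply: Rlt_le; exact: Rinv_0_lt_compat].
have x1 : (1 <= x)%R.
  rewrite /x -(Rpower_O (INR n)); last lra.
  exact: Rle_Rpower.
have xT : pow x (2 * T + 1) = INR (n ^ T).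
  rewrite -Rpower_pow; last lra.
  rewrite /x Rpower_mult /eps (_ : _ * _ = INR T)%R; last by field; lra.
  by rewrite Rpower_pow ?INR_expn //; lra.
have Kx0 : (0 <= INR K * x)%R by nra.
have [lo hi] := archimed (INR K * x).
(* [d] is the integer just above [K * x]; as [x >= 1], it is at most [(K + 1) * x], whence the
   constant [2 * (K + 1)]. *)
have up0 : (0 <= up (INR K * x))%Z by apply: le_IZR; lra.
have [d Ed] := IZN _ up0.
rewrite Ed -INR_IZR_INZ in lo hi.
have Kd : (INR K * x <= INR d)%R by lra.
have dK : K <= d.
  by apply/leP; apply: INR_le; nra.
have d0 : 0 < d by apply/ltP; apply: INR_lt; simpl; nra.
have Kn : K * n ^ T <= d ^ (2 * T + 1).
  apply/leP; apply: INR_le; rewrite mult_INR -xT INR_expn.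
  apply: Rle_trans (pow_incr _ _ (2 * T + 1) (conj Kx0 Kd)).
  rewrite Rpow_mult_distr; apply: Rmult_le_compat_r; first by apply: pow_le; lra.
  by rewrite addn1 -tech_pow_Rmult; have := pow_R1_Rle _ (2 * T) K1; nra.
have bnd : ex (@Hrel T.+2) n <= 2 * d * n.
  by apply/bigmax_leqP => E /andP[Es Ef]; apply: edges_bound Ef.
apply: Rle_trans (le_INR _ _ (elimT leP bnd)) _.
rewrite !mult_INR Rpower_plus Rpower_1; last lra.
rewrite -/eps -/x (_ : INR 2 = 2%R) //.
have : (INR d <= (INR K + 1) * x)%R by nra.
by move=> h; have := Rmult_le_compat_r (INR n) _ _ (pos_INR n) h; nra.
Qed.
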